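(* Let $G$ be a Noetherian group. Then the non-abelian tensor square $G\otimes G$ is Noetherian if and only if the Schur multiplier $M(G)$ is finitely generated.
   Context: A group is Noetherian if all of its subgroups are finitely generated. Write ${}^{g}g'=gg'g^{-1}$. The non-abelian tensor square $G\otimes G$ (all actions being conjugation) is the group generated by symbols $g\otimes h$ ($g,h\in G$) with relations $gg'\otimes h=({}^{g}g'\otimes {}^{g}h)(g\otimes h)$ and $g\otimes hh'=(g\otimes h)({}^{h}g\otimes {}^{h}h')$ for all $g,g',h,h'\in G$. $M(G)=H_2(G,\mathbb{Z})$ is the Schur multiplier. *)

(* Defs.v *)
From HB Require Import structures.
From mathcomp Require Import all_boot all_algebra.
From mathcomp Require Import boolp.
From mathcomp Require Import freeg.

Set Implicit Arguments.
Unset Strict Implicit.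
Unset Printing Implicit Defensive.

Import GRing.Theory.

Local Open Scope quotient_scope.

(* Groups are MathComp's groupType, which are possibly infinite.  In presence
   of the axioms of boolp, {pred G} ranges over all subsets of G. *)

Section Noetherian.
Variable G : groupType.

(* S, assumed to be a subgroup, is generated by a finite list of elements. *)
Definition fg_subgroup (S : {pred G}) : Prop :=
  exists s : seq G, {subset s <= S} /\
    forall T : {pred G}, group_closed T -> {subset s <= T} -> {subset S <= T}.

Definition fg_group : Prop := fg_subgroup predT.

Definition noetherian : Prop :=
  forall S : {pred G}, group_closed S -> fg_subgroup S.

End Noetherian.

Arguments fg_group G : clear implicits.
Arguments noetherian G : clear implicits.

(* The group < X | u = v for R u v >, as words in X and X^-1 modulo the
   congruence generated by R and free cancellation; the letter (x, true)
   stands for x and (x, false) for x^-1. *)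
Section Presentation.
Variables (X : choiceType).

Definition word := seq (X * bool).

Variable R : word -> word -> Prop.

Inductive pres_cong : word -> word -> Prop :=
| pres_refl u : pres_cong u u
| pres_sym u v : pres_cong u v -> pres_cong v u
| pres_trans u v w : pres_cong u v -> pres_cong v w -> pres_cong u w
| pres_cat u u' v v' :
    pres_cong u u' -> pres_cong v v' -> pres_cong (u ++ v) (u' ++ v')
| pres_cancel x b : pres_cong [:: (x, b); (x, ~~ b)] [::]
| pres_rel u v : R u v -> pres_cong u v.

Definition pres_equiv (u v : word) : bool := `[< pres_cong u v >].

Lemma pres_equiv_is_equiv : equiv_class_of pres_equiv.
Proof.
split=> [u|u v|v u w]; first exact/asboolP/pres_refl.
  by apply/asboolP/asboolP=> /pres_sym.
by move=> /asboolP uv /asboolP vw; apply/asboolP/(pres_trans uv).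
Qed.

Canonical pres_equiv_equiv := EquivRelPack pres_equiv_is_equiv.
Canonical pres_equiv_encModRel := defaultEncModRel pres_equiv.

Definition presented := {eq_quot pres_equiv}.

HB.instance Definition _ : EqQuotient word pres_equiv presented :=
  EqQuotient.on presented.
HB.instance Definition _ := Choice.on presented.

Definition word_inv (u : word) : word := rev [seq (x.1, ~~ x.2) | x <- u].

Lemma pres_piP (u v : word) :
  \pi_presented u = \pi_presented v <-> pres_cong u v.
Proof.
split=> [/eqmodP/asboolP //|uv].
by apply/eqmodP/asboolP.
Qed.

Lemma word_invK : involutive word_inv.
Proof.
move=> u; rewrite /word_inv map_rev revK -map_comp map_id_in //.
by move=> [x b] _ /=; rewrite negbK.
Qed.

Lemma word_mulVr (u : word) : pres_cong (u ++ word_inv u) [::].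
Proof.
elim: u => [|[x b] u IHu]; first exact: pres_refl.
rewrite /word_inv map_cons rev_cons -/(word_inv u) -cats1 catA.
apply: pres_trans (pres_cancel x b).
exact: (pres_cat (pres_refl [:: (x, b)]) (pres_cat IHu (pres_refl _))).
Qed.

Lemma word_mulVl (u : word) : pres_cong (word_inv u ++ u) [::].
Proof. by have := word_mulVr (word_inv u); rewrite word_invK. Qed.

Lemma word_inv_cong (u v : word) :
  pres_cong u v -> pres_cong (word_inv u) (word_inv v).
Proof.
move=> uv; rewrite -[word_inv u]cats0 -[word_inv v]cat0s.
apply: (@pres_trans _ (word_inv u ++ v ++ word_inv v)).
  exact/(pres_cat (pres_refl _))/pres_sym/word_mulVr.
rewrite catA; apply: pres_cat (pres_refl _).
apply: pres_trans (word_mulVl u).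
exact/(pres_cat (pres_refl _))/pres_sym.
Qed.

Definition pres_one : presented := \pi_presented [::].
Definition pres_mul (a b : presented) : presented :=
  \pi_presented (repr a ++ repr b).
Definition pres_inv (a : presented) : presented :=
  \pi_presented (word_inv (repr a)).

Lemma pres_repr (u : word) : pres_cong (repr (\pi_presented u)) u.
Proof. by apply/pres_piP; rewrite reprK. Qed.

Lemma pres_mul_pi (u v : word) :
  pres_mul (\pi_presented u) (\pi_presented v) = \pi_presented (u ++ v).
Proof. by apply/pres_piP; apply: pres_cat; apply: pres_repr. Qed.

Lemma pres_inv_pi (u : word) :
  pres_inv (\pi_presented u) = \pi_presented (word_inv u).
Proof. by apply/pres_piP/word_inv_cong/pres_repr. Qed.

Lemma pres_mulA : associative pres_mul.
Proof.
by elim/quotW=> u; elim/quotW=> v; elim/quotW=> w;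
rewrite (pres_mul_pi v) (pres_mul_pi u v) !pres_mul_pi catA.
Qed.

Lemma pres_mul1 : left_id pres_one pres_mul.
Proof. by elim/quotW=> u; rewrite pres_mul_pi. Qed.

Lemma pres_mulr1 : right_id pres_one pres_mul.
Proof. by elim/quotW=> u; rewrite pres_mul_pi cats0. Qed.

Lemma pres_mulV : left_inverse pres_one pres_inv pres_mul.
Proof.
elim/quotW=> u; rewrite pres_inv_pi pres_mul_pi.
exact/pres_piP/word_mulVl.
Qed.

Lemma pres_mulrV : right_inverse pres_one pres_inv pres_mul.
Proof.
elim/quotW=> u; rewrite pres_inv_pi pres_mul_pi.
exact/pres_piP/word_mulVr.
Qed.

HB.instance Definition _ := isGroup.Build presented
  pres_mulA pres_mul1 pres_mulr1 pres_mulV pres_mulrV.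

End Presentation.

Section TensorSquare.
Variable G : groupType.

Definition lconj (g x : G) : G := (g * x * g^-1)%g.

Definition tensor_letter (g h : G) : word (G * G)%type := [:: ((g, h), true)].

Inductive tensor_rel : word (G * G)%type -> word (G * G)%type -> Prop :=
| tensor_rel_mull g g' h :
    tensor_rel (tensor_letter (g * g')%g h)
      (tensor_letter (lconj g g') (lconj g h) ++ tensor_letter g h)
| tensor_rel_mulr g h h' :
    tensor_rel (tensor_letter g (h * h')%g)
      (tensor_letter g h ++ tensor_letter (lconj h g) (lconj h h')).

Definition tensor_square : groupType := presented tensor_rel.

Definition tens (g h : G) : tensor_square :=
  \pi_(presented tensor_rel) (tensor_letter g h).

Lemma tens_mull g g' h :
  tens (g * g')%g h = (tens (lconj g g') (lconj g h) * tens g h)%g.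
Proof. by rewrite [RHS]pres_mul_pi; apply/pres_piP/pres_rel/tensor_rel_mull. Qed.

Lemma tens_mulr g h h' :
  tens g (h * h')%g = (tens g h * tens (lconj h g) (lconj h h'))%g.
Proof. by rewrite [RHS]pres_mul_pi; apply/pres_piP/pres_rel/tensor_rel_mulr. Qed.

End TensorSquare.

(* H_2(G, Z), computed from the (unnormalized, inhomogeneous) bar complex
   of G with trivial coefficients: the chain group C_n is free abelian on G^n. *)
Section SchurMultiplier.
Variable G : groupType.
Local Open Scope ring_scope.

Definition bar1 := {freeg G}.
Definition bar2 := {freeg (G * G)%type}.
Definition bar3 := {freeg (G * G * G)%type}.

Definition bar_d2 : bar2 -> bar1 :=
  fglift (fun x : G * G => let: (g, h) := x in
    << h >> - << (g * h)%g >> + << g >> : bar1).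

Definition bar_d3 : bar3 -> bar2 :=
  fglift (fun x : G * G * G => let: (g, h, k) := x in
    << (h, k) >> - << ((g * h)%g, k) >> + << (g, (h * k)%g) >> - << (g, h) >>
      : bar2).

HB.instance Definition _ := GRing.isZmodMorphism.Build bar2 bar1 bar_d2
  (lift_is_additive _).
HB.instance Definition _ := GRing.isZmodMorphism.Build bar3 bar2 bar_d3
  (lift_is_additive _).

Lemma bar_d2U g h : bar_d2 << (g, h) >> = << h >> - << (g * h)%g >> + << g >>.
Proof. by rewrite [LHS]liftU scale1r. Qed.

Lemma bar_d2_d3 (c : bar3) : bar_d2 (bar_d3 c) = 0.
Proof.
rewrite -[c]freeg_sumE !raddf_sum big1 // => -[[g h] k] _.
rewrite /= [bar_d3 _]liftU.
set m := coeff _ _; rewrite -[m]intz scaler_int raddfMz /=.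
rewrite raddfB raddfD raddfB /= !bar_d2U mulgA !opprD !opprK !addrA.
rewrite [X in X *~ _](ACl
  ((1 * 4) * (2 * 7) * (3 * 10) * (5 * 8) * (6 * 11) * (9 * 12))) /=.
by rewrite !subrr !addNr !addr0 mul0rz.
Qed.

Definition cycles2 : {pred bar2} := [pred c | bar_d2 c == 0].

Lemma cycles2_zmod_closed : zmod_closed cycles2.
Proof.
split=> [|x y]; rewrite !inE; first by rewrite raddf0.
by move=> /eqP dx /eqP dy; rewrite raddfB /= dx dy subrr.
Qed.

HB.instance Definition _ := GRing.isZmodClosed.Build bar2 cycles2
  cycles2_zmod_closed.

Record cycle2 := Cycle2 { cycle2_val :> bar2; _ : cycle2_val \in cycles2 }.

HB.instance Definition _ := [isSub for cycle2_val].
HB.instance Definition _ := [Choice of cycle2 by <:].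
HB.instance Definition _ := [SubChoice_isSubZmodule of cycle2 by <:].

Definition boundaries2 : {pred cycle2} :=
  [pred z : cycle2 | `[< exists c : bar3, val z = bar_d3 c >]].

Lemma boundaries2_zmod_closed : zmod_closed boundaries2.
Proof.
split=> [|x y]; rewrite !inE; first by apply/asboolP; exists 0; rewrite !raddf0.
move=> /asboolP[c dc] /asboolP[d dd]; apply/asboolP; exists (c - d).
by rewrite !raddfB /= dc dd.
Qed.

HB.instance Definition _ := GRing.isZmodClosed.Build cycle2 boundaries2
  boundaries2_zmod_closed.

Definition schur_multiplier : zmodType := Quotient.quot boundaries2.

End SchurMultiplier.

(* Main.v *)
Require Import Defs.
From HB Require Import structures.
From mathcomp Require Import all_boot all_algebra.
From mathcomp Require Import boolp freeg zify.

Set Implicit Arguments.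
Unset Strict Implicit.
Unset Printing Implicit Defensive.

Import GRing.Theory.

Local Open Scope group_scope.

(** Write [T] for the tensor square of [G], [M] for the Schur multiplier and [K]
   for the group of 2-chains of the bar complex modulo boundaries.  The classes
   of the basis elements [(g, h)] form a 2-cocycle with values in [K], hence a
   central extension [E] of [G] by [K] ([bar_ext]).  Commutators of lifts to [E]
   depend only on the elements lifted, so [g (x) h |-> [lift g, lift h]] is a
   homomorphism [tensor_ext] from [T] to [E], lying over the commutator map [bd]
   from [T] to [G].  Everything follows from comparing [M] with it inside [E].

   The map [(a, g) |-> << g >> + bar_d2 a] from [E] to the free abelian group on
   [G] has the commutator subgroup of [E] as its kernel: [E] is generated by the
   canonical lifts of the elements of [G], which are sent to the basis, and a
   word with vanishing exponent sums is a product of commutators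
   ([bar_ab_ker]).  On [K] this map is the boundary, so [M], which consists of
   the cycles of [K], is the intersection of [K] with the commutator subgroup
   of [E] ([schur_emb_range], [schur_emb_ab]).  In particular [M] lies in the
   image of [T] ([schur_emb_tensor_ext]); if [T] is Noetherian, so are its
   image and [M], and [M] is finitely generated.

   Conversely [T] is built from three pieces: its image [[G, G]] in [G], the
   image of [ker bd] in [E], which lies in [M], and the kernel of [tensor_ext].
   The first is Noetherian because [G] is, the second because subgroups of
   finitely generated abelian groups are finitely generated
   ([noeth_on_gen_commute]).  The third is contained in the subgroup generated
   by the elements [g (x) g].  That subgroup is central, and [g |-> g (x) g] is
   quadratic, so generators of [G] provide finitely many generators for it
   ([diag_fg]).

   The containment says that the exterior square [W], the quotient of [T] by
   the [g (x) g], is detected by [E].  As [E] maps to every central extension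
   of [G], it is enough to find one whose commutator map [W -> [L, L]] is
   injective.  Such an [L] is obtained from [W] itself ([realization_self]) by
   adjoining lifts of finitely many generators of [G], each time as a
   semidirect product with a cyclic subgroup [H] of [G], where [h] acts on [l]
   in the only possible way, [l |-> (h /\ l) l] ([realization_adjoin]). *)

(** * Homomorphisms, commutators and generated subgroups *)

Section Homomorphism.
Variables (G H : groupType) (f : G -> H).
Hypothesis fM : {morph f : x y / x * y}.

Lemma hom1 : f 1 = 1.
Proof. by apply: (mulgI (f 1)); rewrite -fM !mulg1. Qed.

Lemma homV : {morph f : x / x^-1}.
Proof. by move=> x; apply: (mulIg (f x)); rewrite -fM !mulVg hom1. Qed.

Lemma homF : {morph f : x y / x / y}.
Proof. by move=> x y; rewrite fM homV. Qed.

Lemma hom_inj : (forall x, f x = 1 -> x = 1) -> injective f.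
Proof.
move=> ker1 x y exy; apply: divg1_eq; apply: ker1.
by rewrite homF exy mulgV.
Qed.

Lemma image_closed (S : {pred G}) :
  group_closed S -> group_closed [pred y | `[< exists2 x, x \in S & f x = y >]].
Proof.
move=> [S1 SF]; split; first by apply/asboolP; exists 1; rewrite ?hom1.
move=> _ _ /asboolP[x Sx <-] /asboolP[y Sy <-]; apply/asboolP.
by exists (x / y); rewrite ?homF //; apply: SF.
Qed.

End Homomorphism.

(** The convention [x y x^-1 y^-1], unlike that of the notation [[~ x, y]], fits
   the left conjugation [lconj] of the tensor relations. *)
Definition lcomm (G : groupType) (x y : G) : G := x * y / x / y.

Lemma lconjM (G : groupType) (g : G) : {morph lconj g : x y / x * y}.
Proof. by move=> x y; rewrite /lconj !gnorm. Qed.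

Lemma hom_lcomm (G H : groupType) (f : G -> H) :
  {morph f : x y / x * y} -> {morph f : x y / lcomm x y}.
Proof. by move=> fM x y; rewrite /lcomm !(homF fM) fM. Qed.

Lemma hom_lconj (G H : groupType) (f : G -> H) :
  {morph f : x y / x * y} -> {morph f : x y / lconj x y}.
Proof. by move=> fM x y; rewrite /lconj (homF fM) fM. Qed.

Definition gen (G : groupType) (s : seq G) : {pred G} :=
  [pred x | `[< forall T : {pred G},
    group_closed T -> {subset s <= T} -> x \in T >]].

Section Generated.
Variable G : groupType.
Implicit Types (s : seq G) (S T : {pred G}).

Lemma genP s T x : x \in gen s -> group_closed T -> {subset s <= T} -> x \in T.
Proof. by move=> /asboolP; apply. Qed.

Lemma gen_closed s : group_closed (gen s).
Proof.
split=> [|x y /asboolP xs /asboolP ys]; apply/asboolP=> T cT sT.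
  by case: cT.
by apply: (proj2 cT); [apply: xs | apply: ys].
Qed.

Lemma mem_gen s : {subset s <= gen s}.
Proof. by move=> x xs; apply/asboolP=> T _; apply. Qed.

Lemma gen_sub s T : group_closed T -> {subset s <= T} -> {subset gen s <= T}.
Proof. by move=> cT sT x /genP; apply. Qed.

Lemma fg_subgroupP S :
  fg_subgroup S <-> exists2 s, {subset s <= S} & {subset S <= gen s}.
Proof.
split=> [[s [sS minS]]|[s sS Ss]]; exists s => //.
  by apply: minS; [apply: gen_closed | apply: mem_gen].
by split=> // T cT sT x /Ss; apply: gen_sub.
Qed.

Lemma predI_closed S T :
  group_closed S -> group_closed T -> group_closed [predI S & T].
Proof.
move=> [S1 SF] [T1 TF]; split; first by rewrite !inE; apply/andP.
move=> x y /andP[xS xT] /andP[yS yT].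
by rewrite !inE; apply/andP; split; [apply: SF | apply: TF].
Qed.

Lemma centralizer_closed (P : {pred G}) :
  group_closed [pred x | `[< forall y, y \in P -> commute x y >]].
Proof.
split=> [|x y /asboolP cx /asboolP cy]; apply/asboolP=> z Pz.
  exact/commute_sym/commute1.
apply/commute_sym/commuteM; first exact/commute_sym/cx.
exact/commuteV/commute_sym/cy.
Qed.

Lemma gen_commute s :
  {in s &, forall x y, commute x y} -> {in gen s &, forall x y, commute x y}.
Proof.
move=> cs x y xs ys.
pose C1 : {pred G} := [pred x | `[< forall y, y \in s -> commute x y >]].
pose C2 : {pred G} := [pred x | `[< forall y, y \in gen s -> commute x y >]].
have sC1 : {subset gen s <= C1}.
  apply: gen_sub; first exact: centralizer_closed.
  by move=> z zs; apply/asboolP=> t ts; apply: cs.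
have sC2 : {subset s <= C2}.
  by move=> z zs; apply/asboolP=> t /sC1/asboolP/(_ _ zs)/commute_sym.
by have /asboolP := gen_sub (centralizer_closed _) sC2 xs; apply.
Qed.

End Generated.

(** * Noetherian subsets *)

(** Relative to an ambient group, so that kernels and images need not be made
   into groups of their own. *)
Definition noeth_on (G : groupType) (P : {pred G}) : Prop :=
  forall S : {pred G}, group_closed S -> {subset S <= P} -> fg_subgroup S.

Lemma noetherianE (G : groupType) : noetherian G <-> noeth_on (@predT G).
Proof. by split=> nG S cS; [move=> _|]; apply: nG. Qed.

Lemma noeth_onS (G : groupType) (P Q : {pred G}) :
  {subset P <= Q} -> noeth_on Q -> noeth_on P.
Proof. by move=> PQ nQ S cS SP; apply: nQ => // x /SP/PQ. Qed.

Lemma noeth_on_seq (G : groupType) (P S : {pred G}) :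
    noeth_on P -> group_closed S -> {subset S <= P} ->
  exists2 s, {subset s <= S} & {subset S <= gen s}.
Proof. by move=> nP cS SP; apply/fg_subgroupP/nP. Qed.

Section NoetherianHom.
Variables (A B : groupType) (f : A -> B).
Hypothesis fM : {morph f : x y / x * y}.

Lemma lift_seq (S : {pred A}) (t : seq B) :
  {in t, forall y, exists2 x, x \in S & f x = y} ->
  exists2 s, {subset s <= S} & map f s = t.
Proof.
elim: t => [|y t IHt] ht; first by exists [::].
have [|s sS <-] := IHt; first by move=> z zt; apply: ht; rewrite inE zt orbT.
have [|x xS <-] := ht y; first by rewrite inE eqxx.
exists (x :: s) => // z; rewrite inE => /orP[/eqP-> //|]; exact: sS.
Qed.

Lemma gen_lift (s : seq A) y :
  y \in gen (map f s) -> exists2 x, x \in gen s & f x = y.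
Proof.
move=> ys; apply/asboolP; move: y ys; apply: gen_sub.
  exact/image_closed/gen_closed.
by move=> _ /mapP[x xs ->]; apply/asboolP; exists x => //; apply: mem_gen.
Qed.

(** Generators of [f(S)], lifted to [S], together with generators of the
   intersection of [S] and [ker f], generate [S]. *)
Lemma noeth_on_ext (P : {pred A}) (Q : {pred B}) :
    {in P, forall x, f x \in Q} -> noeth_on Q ->
  noeth_on [pred x in P | f x == 1] -> noeth_on P.
Proof.
move=> fPQ nQ nK S cS SP.
pose fS : {pred B} := [pred y | `[< exists2 x, x \in S & f x = y >]].
have [||t tfS fSt] := @noeth_on_seq _ _ fS nQ; first exact: image_closed.
  by move=> _ /asboolP[x /SP/fPQ ? <-].
have [|s sS ft] := @lift_seq S t; first by move=> y /tfS/asboolP.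
have cK : group_closed [pred x | f x == 1].
  split=> [|x y]; rewrite !inE ?hom1 // => /eqP fx /eqP fy.
  by rewrite homF // fx fy mulgV.
have [|u uK Ku] := noeth_on_seq nK (predI_closed cS cK).
  by move=> x /andP[/SP xP fx]; rewrite inE; apply/andP.
apply/fg_subgroupP; exists (s ++ u) => [x|x xS].
  by rewrite mem_cat => /orP[/sS //|/uK/andP[]].
have /fSt : f x \in fS by apply/asboolP; exists x.
rewrite -ft => /gen_lift[x' x's fx'].
have gs : {subset gen s <= gen (s ++ u)}.
  apply: gen_sub => [|z zs]; first exact: gen_closed.
  by apply: mem_gen; rewrite mem_cat zs.
have gu : {subset gen u <= gen (s ++ u)}.
  apply: gen_sub => [|z zu]; first exact: gen_closed.
  by apply: mem_gen; rewrite mem_cat zu orbT.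
rewrite -(mulgVK x' x); apply: (group_closedM (gen_closed _)); last exact: gs.
apply/gu/Ku; rewrite !inE; apply/andP; split; last by rewrite homF // fx' mulgV.
by apply: (proj2 cS) => //; apply: (gen_sub cS sS).
Qed.

Lemma noeth_on_inj (P : {pred A}) (Q : {pred B}) :
  injective f -> {in P, forall x, f x \in Q} -> noeth_on Q -> noeth_on P.
Proof.
move=> finj fPQ nQ; apply: (noeth_on_ext fPQ nQ) => S cS SK.
apply/fg_subgroupP; exists [::] => // x /SK/andP[_ /eqP fx].
by rewrite (finj x 1) ?hom1 //; case: (gen_closed (@nil A)).
Qed.

Lemma noeth_on_image (P : {pred A}) :
  group_closed P -> noeth_on P ->
  noeth_on [pred y | `[< exists2 x, x \in P & f x = y >]].
Proof.
move=> cP nP S cS SfP.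
pose S' : {pred A} := [pred x in P | f x \in S].
have cS' : group_closed S'.
  split; first by rewrite !inE hom1 //; apply/andP; split; [case: cP|case: cS].
  move=> x y /andP[xP xS] /andP[yP yS]; rewrite !inE homF //.
  by apply/andP; split; [apply: (proj2 cP)|apply: (proj2 cS)].
have [|s sS' S's] := noeth_on_seq nP cS'; first by move=> x /andP[].
apply/fg_subgroupP; exists (map f s) => [_ /mapP[x /sS'/andP[_ xS] ->] //|y yS].
have /asboolP[x xP fxy] := SfP y yS; rewrite -fxy.
have xs : x \in gen s by apply: S's; rewrite !inE; apply/andP; rewrite fxy.
suff /(_ x xs) : {subset gen s <= [pred x | f x \in gen (map f s)]} by [].
apply: gen_sub => [|z zs]; last by rewrite inE; apply/mem_gen/map_f.
have [g1 gF] := gen_closed (map f s).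
by split=> [|u v]; rewrite !inE ?hom1 ?homF //; apply: gF.
Qed.

End NoetherianHom.

(** The inductive step splits off one generator [a]: the least [d > 0] for which
   a subgroup [S] contains an element [a ^+ d * y], [y] a product of the other
   generators, takes the role of a generator of the ideal of [a]-exponents
   occurring in [S]. *)
Lemma noeth_on_gen_commute (G : groupType) (s : seq G) :
  {in s &, forall x y, commute x y} -> noeth_on (gen s).
Proof.
elim: s => [|a s IHs] cs S cS Sas.
  by apply/fg_subgroupP; exists [::].
have cs' : {in s &, forall x y, commute x y}.
  by move=> x y xs ys; apply: cs; rewrite inE ?xs ?ys orbT.
have cg := gen_commute cs.
have gs : {subset gen s <= gen (a :: s)}.
  apply: gen_sub => [|z zs]; first exact: gen_closed.
  by apply: mem_gen; rewrite inE zs orbT.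
have ga : a \in gen (a :: s) by apply: mem_gen; rewrite inE eqxx.
have ca n y : y \in gen s -> commute (a ^+ n) y.
  by move=> /gs/(cg _ _ ga)/commute_sym/(@commuteX _ y a n)/commute_sym.
have cgs := gen_closed s.
(* Integral exponents of [a] are written as differences of natural ones. *)
pose P : {pred G} :=
  [pred x | `[< exists m n,
    exists2 y, y \in gen s & x = a ^+ m / a ^+ n * y >]].
have cP : group_closed P.
  split.
    by apply/asboolP; exists 0, 0, 1; [case: cgs|rewrite expg0 !gnorm].
  move=> _ _ /asboolP[m [n [y ys ->]]] /asboolP[k [l [z zs ->]]].
  apply/asboolP; exists (m + l), (n + k), (y / z); first exact: (proj2 cgs).
  have cyz : commute (y / z) (a ^+ l / a ^+ k).
    have yz : y / z \in gen s by apply: (proj2 cgs).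
    by apply: commuteM; [|apply: commuteV]; apply/commute_sym/ca.
  have cnl : commute (a ^- n) (a ^+ l).
    by apply/commute_sym/commuteV/commuteX2/commute_refl.
  have -> : a ^+ m / a ^+ n * y / (a ^+ k / a ^+ l * z)
          = a ^+ m / a ^+ n * ((y / z) * (a ^+ l / a ^+ k)) by rewrite !gnorm.
  rewrite cyz [(n + k)%N]addnC !expgnDr invgM !mulgA; congr (_ / _ * _ / _).
  by rewrite -!mulgA cnl.
have SP x : x \in S -> x \in P.
  move=> /Sas; apply: gen_sub => // z; rewrite inE => /orP[/eqP->|zs].
    by apply/asboolP; exists 1%N, 0, 1; [case: cgs|rewrite !gnorm].
  by apply/asboolP; exists 0, 0, z; [apply: mem_gen|rewrite expg0 !gnorm].
(* Up to inversion, the exponent of [a] in an element of [S] is natural. *)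
have signed (x : G) : x \in S -> exists n, exists2 y, y \in gen s &
    a ^+ n * y \in S /\ (x = a ^+ n * y \/ x^-1 = a ^+ n * y).
  move=> xS; have /asboolP[m [n [y ys ex]]] := SP x xS.
  have [nm|/ltnW mn] := leqP n m.
    exists (m - n), y => //.
    have exS : x = a ^+ (m - n) * y by rewrite ex expgnFr.
    by rewrite -exS; split; [|left].
  exists (n - m), y^-1; first exact: group_closedV.
  have exS : x^-1 = a ^+ (n - m) / y.
    rewrite ex expgnFr // !gnorm -mulgA.
    have nmy : commute (a ^+ n / a ^+ m) y^-1.
      apply/commuteV/commute_sym/commuteM; first exact/commute_sym/ca.
      exact/commuteV/commute_sym/ca.
    by rewrite -nmy.
  by rewrite -exS; split; [apply: group_closedV|right].
pose D n := `[< (0 < n)%N /\ exists2 y, y \in gen s & a ^+ n * y \in S >].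
have nSs : fg_subgroup [predI S & gen s].
  by apply: (IHs cs') => [|x /andP[]//]; apply: predI_closed.
have [u uS Su] := proj1 (fg_subgroupP _) nSs.
have [exD|noD] := pselect (exists n, D n); last first.
  apply/fg_subgroupP; exists u => [x /uS/andP[]//|x xS]; apply: Su.
  apply/andP; split=> //.
  have [n [y ys [ayS hx]]] := signed x xS.
  have n0 : n = 0.
    apply/eqP; rewrite -leqn0 leqNgt; apply/negP=> n_gt0; apply: noD.
    by exists n; apply/asboolP; split=> //; exists y.
  rewrite n0 expg0 mul1g in hx; case: hx => [->//|hx].
  by rewrite -(invgK x) hx; apply: group_closedV.
case: (ex_minnP exD) => d /asboolP[d_gt0 [z zs azS]] dmin.
apply/fg_subgroupP; exists (a ^+ d * z :: u) => [x|x xS].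
  by rewrite inE => /orP[/eqP->//|/uS/andP[]].
have cgu := gen_closed (a ^+ d * z :: u).
have gu : {subset gen u <= gen (a ^+ d * z :: u)}.
  by apply: gen_sub => // t tu; apply: mem_gen; rewrite inE tu orbT.
suff pos n y : y \in gen s -> a ^+ n * y \in S ->
    a ^+ n * y \in gen (a ^+ d * z :: u).
  have [n [y ys [ayS [->|exV]]]] := signed x xS; first exact: pos.
  by rewrite -(invgK x) exV; apply: group_closedV => //; apply: pos.
move=> ys ayS.
have cX k : forall T : {pred G}, group_closed T -> a ^+ d * z \in T ->
    (a ^+ d * z) ^+ k \in T.
  move=> T cT Tz; elim: k => [|k IHk]; first by case: cT.
  by rewrite expgS; apply: group_closedM.
have Xz k : z ^+ k \in gen s.
  by elim: k => [|k IHk]; [case: cgs|rewrite expgS; apply: group_closedM].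
set q := (n %/ d)%N; set r := (n %% d)%N.
have eay : a ^+ n * y = (a ^+ d * z) ^+ q * (a ^+ r * (y / z ^+ q)).
  rewrite expgMn; last exact: ca.
  rewrite -expgnA {1}(divn_eq n d) -/q -/r [(q * d)%N]mulnC expgnDr -!mulgA.
  congr (_ * _); rewrite [RHS]mulgA -ca // -mulgA; congr (_ * _).
  rewrite mulgA -[LHS](mulgVK (z ^+ q)) -mulgA mulgA.
  have -> : z ^+ q * y = y * z ^+ q by apply: (gen_commute cs').
  by rewrite mulgVK mulgK.
have yzs : y / z ^+ q \in gen s by apply: (proj2 cgs).
have ryS : a ^+ r * (y / z ^+ q) \in S.
  rewrite -(mulKg ((a ^+ d * z) ^+ q) (a ^+ r * _)) -eay.
  by apply: group_closedM => //; apply: group_closedV => //; apply: cX.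
have r0 : r = 0%N.
  apply/eqP; rewrite -leqn0 leqNgt; apply/negP=> r_gt0.
  have /dmin : D r by apply/asboolP; split=> //; exists (y / z ^+ q).
  by rewrite leqNgt ltn_mod d_gt0.
rewrite eay; apply: group_closedM => //.
  by apply: cX => //; apply: mem_gen; rewrite inE eqxx.
apply/gu/Su/andP; split=> //.
by rewrite r0 expg0 mul1g.
Qed.

(** * Crossed pairings *)

(** The structure shared by the non-abelian tensor and exterior squares: a
   crossed module [bd : W -> G] together with a pairing [pr] lifting the
   commutator map, whose values generate [W]. *)
Record crossed_pairing (G W : groupType) := CrossedPairing {
  pr : G -> G -> W;
  act : G -> W -> W;
  bd : W -> G;
  prMl : forall g g' h, pr (g * g') h = act g (pr g' h) * pr g h;
  prMr : forall g h h', pr g (h * h') = pr g h * act h (pr g h');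
  actM : forall g, {morph act g : v w / v * w};
  act_pr : forall g x y, act g (pr x y) = pr (lconj g x) (lconj g y);
  bdM : {morph bd : v w / v * w};
  bd_pr : forall x y, bd (pr x y) = lcomm x y;
  pr_gen : forall S : {pred W},
    group_closed S -> (forall x y, pr x y \in S) -> forall w, w \in S
}.

Section CrossedPairing.
Variables (G W : groupType) (T : crossed_pairing G W).
Implicit Types (g h k x y : G) (v w : W).
Local Notation p := (pr T).
Local Notation a := (act T).
Local Notation d := (bd T).

Lemma pr_ind (P : W -> Prop) :
    P 1 -> (forall v w, P v -> P w -> P (v / w)) -> (forall x y, P (p x y)) ->
  forall w, P w.
Proof.
move=> P1 PF Pp w; suff /asboolP : w \in [pred w | `[< P w >]] by [].
apply: (pr_gen (c := T) (S := [pred w | `[< P w >]])) => [|x y].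
  2: exact/asboolP.
by split=> [|u v /asboolP Pu /asboolP Pv]; apply/asboolP; [|apply: PF].
Qed.

Lemma pr_ext (H : groupType) (f f' : W -> H) :
    {morph f : v w / v * w} -> {morph f' : v w / v * w} ->
  (forall x y, f (p x y) = f' (p x y)) -> f =1 f'.
Proof.
move=> fM f'M e; apply: pr_ind => // [|v w fv fw].
  by rewrite (hom1 fM) (hom1 f'M).
by rewrite (homF fM) (homF f'M) fv fw.
Qed.

Lemma act1g w : a 1 w = w.
Proof.
move: w; apply: pr_ext; [exact: actM | by [] |] => x y.
by rewrite act_pr /lconj !gnorm.
Qed.

Lemma actMg g h w : a (g * h) w = a g (a h w).
Proof.
move: w; apply: pr_ext => [|v w|x y]; [exact: actM | by rewrite !actM |].
by rewrite !act_pr /lconj !gnorm.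
Qed.

Lemma actV g : {morph a g : w / w^-1}.
Proof. exact/homV/actM. Qed.

Lemma pr1g h : p 1 h = 1.
Proof. by apply: (mulIg (p 1 h)); rewrite -{1}[p 1 h]act1g -prMl !mul1g. Qed.

Lemma prg1 g : p g 1 = 1.
Proof.
by apply: (mulgI (p g 1)); rewrite -{2}[p g 1]act1g -prMr !mulg1.
Qed.

Lemma prVl g h : p g^-1 h = (a g^-1 (p g h))^-1.
Proof. by rewrite -[RHS]mulg1 -(pr1g h) -(mulVg g) prMl mulKg. Qed.

Lemma prVr g h : p g h^-1 = (a h^-1 (p g h))^-1.
Proof. by rewrite -[RHS]mul1g -(prg1 g) -(mulVg h) prMr mulgK. Qed.

(** Expand [p (g * x) (h * y)] in the two possible orders and cancel the outer
   factors; this gives the case [w = p x y], which suffices. *)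
Lemma act_lcomm g h w : a (g * h) w * p g h = p g h * a (h * g) w.
Proof.
suff key v : a (g * h) v = p g h * a (h * g) v / p g h.
  by rewrite key mulgVK.
move: v; apply: pr_ext => [|u v|x y]; first exact: actM.
  by rewrite actM !gnorm.
have : p (g * x) (h * y) = p (g * x) (h * y) by [].
rewrite {1}prMl prMr [p g (h * y)]prMr prMr [p (g * x) h]prMl [p (g * x) y]prMl.
rewrite !actM -!actMg -!mulgA => /mulgI; rewrite !mulgA => /mulIg.
by move=> <-; rewrite mulgK.
Qed.

(** The Peiffer identity, making [d] a crossed module: for [v = p x y] it is
   [act_lcomm] with [w] replaced by its translate under [(y * x)^-1]. *)
Lemma peiffer v w : a (d v) w = v * w / v.
Proof.
move: v w; apply: pr_ind => [w|s t hs ht w|x y w].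
- by rewrite (hom1 (@bdM _ _ T)) act1g !gnorm.
- rewrite (homF (@bdM _ _ T)) actMg hs.
  have ew := ht (a (d t)^-1 w); rewrite -actMg mulgV act1g in ew.
  by rewrite {2}ew !gnorm.
rewrite bd_pr /lcomm.
have := act_lcomm x y (a (y * x)^-1 w).
rewrite -!actMg mulgV act1g invgM !mulgA.
by move=> <-; rewrite mulgK.
Qed.

(** On a generator [w = p g h] the commutator [d w] is the product of [g] and a
   conjugate of [g^-1]; expanding [p] there leaves [p g (h^-1 k h)] to be
   computed. *)
Lemma pr_bd w k : p (d w) k = w / a k w.
Proof.
move: w; apply: pr_ind => [|s t hs ht|g h].
- by rewrite (hom1 (@bdM _ _ T)) pr1g (hom1 (@actM _ _ T k)) !gnorm.
- rewrite (homF (@bdM _ _ T)) prMl hs prVl ht -(homV (@bdM _ _ T)) !peiffer.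
  by rewrite (homF (@actM _ _ T k)) !gnorm.
rewrite bd_pr.
(* [ec] keeps [p g (h^-1 k h)] in the form [a h^-1 _], so that the actions
   compose to that of [d (p g h)], which is conjugation by [p g h]. *)
have -> : lcomm g h = g * lconj h g^-1 by rewrite /lcomm /lconj !gnorm.
have ek : p (lconj h g^-1) k = a h (p g^-1 (lconj h^-1 k)).
  by rewrite act_pr; congr (p _ _); rewrite /lconj !gnorm.
have ec : p g (lconj h^-1 k) = a h^-1 ((p g h)^-1 * p g k * a k (p g h)).
  rewrite /lconj invgK -mulgA prMr prVr [p g (k * h)]prMr -!actV -!actM.
  by rewrite mulgA.
have ed v : a g (a h (a g^-1 (a h^-1 v))) = a (d (p g h)) v.
  by rewrite bd_pr /lcomm !actMg.
rewrite prMl ek prVl ec -!actV ed.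
by rewrite peiffer !gnorm actV.
Qed.

(** Compare [pr_bd] with [p 1 k = 1]. *)
Lemma act_ker w k : d w = 1 -> a k w = w.
Proof.
move=> dw; have := pr_bd w k; rewrite dw pr1g => /esym/eqP.
by rewrite divg_eq1 => /eqP.
Qed.

Lemma ker_central v w : d v = 1 -> commute v w.
Proof.
move=> dv; have e := peiffer v w; rewrite dv act1g in e.
by rewrite /commute {2}e mulgVK.
Qed.

(** * The diagonal of a crossed pairing *)

(** The polarization of the diagonal, see [prMxx]. *)
Definition prsym g h : W := p g h * p h g.

Lemma bd_prsym g h : d (prsym g h) = 1.
Proof. by rewrite bdM !bd_pr /lcomm !gnorm. Qed.

Lemma bd_prxx g : d (p g g) = 1.
Proof. by rewrite bd_pr /lcomm !gnorm. Qed.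

Lemma prsymC g h : prsym g h = prsym h g.
Proof.
have -> : prsym h g = (p g h)^-1 * (prsym g h * p g h) by rewrite /prsym !gnorm.
by rewrite (ker_central (p g h) (bd_prsym g h)) mulKg.
Qed.

Lemma prsymMl g g' h : prsym (g * g') h = prsym g h * prsym g' h.
Proof.
rewrite {1}/prsym prMl prMr.
have -> : a g (p g' h) * p g h * (p h g * a g (p h g')) =
  a g (p g' h) * (prsym g h * a g (p h g')) by rewrite /prsym !mulgA.
rewrite (ker_central (a g (p h g')) (bd_prsym g h)) mulgA -actM.
rewrite (act_ker _ (bd_prsym g' h)).
exact: ker_central (bd_prsym g' h).
Qed.

Lemma prMxx g h : p (g * h) (g * h) = p g g * p h h * prsym h g.
Proof.
rewrite prMl [p h (g * h)]prMr [p g (g * h)]prMr.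
rewrite actM !(act_ker _ (bd_prxx h)) -[prsym h g](act_ker g (bd_prsym h g)).
rewrite /prsym !actM; set v := a g (p h g); set w := a g (p g h).
rewrite mulgA -(ker_central v (bd_prxx h)) -(mulgA (p h h) v).
rewrite -(ker_central v (bd_prxx g)) mulgA (ker_central _ (bd_prxx h)).
by rewrite -!mulgA.
Qed.

Definition diag_gens (s : seq G) : seq W :=
  [seq p x x | x <- s] ++ [seq prsym x y | x <- s, y <- s].

Lemma diag_gens_ker s w : w \in diag_gens s -> d w = 1.
Proof.
rewrite mem_cat => /orP[/mapP[x _ ->]|/allpairsP[[x y] [_ _ ->]]].
  exact: bd_prxx.
exact: bd_prsym.
Qed.

(** The diagonal is a quadratic function with bimultiplicative polarization
   [prsym], so its values and polarizations at generators of [G] suffice. *)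
Lemma diag_fg (s : seq G) :
  {subset predT <= gen s} -> forall g, p g g \in gen (diag_gens s).
Proof.
move=> Gs; have cD := gen_closed (diag_gens s); have [D1 DF] := cD.
have ind (P : G -> Prop) : P 1 -> (forall g h, P g -> P h -> P (g / h)) ->
    (forall g, g \in s -> P g) -> forall g, P g.
  move=> P1 PF Ps g; suff /asboolP : g \in [pred g | `[< P g >]] by [].
  apply: (genP (Gs g isT)) => [|x xs]; last exact/asboolP/Ps.
  by split=> [|x y /asboolP Px /asboolP Py]; apply/asboolP; [|apply: PF].
have prsymVl g h : prsym g^-1 h = (prsym g h)^-1.
  apply: (mulIg (prsym g h)); rewrite -prsymMl !mulVg.
  by rewrite /prsym pr1g prg1 mulg1.
have prsymFl g h k : prsym (g / h) k = prsym g k / prsym h k.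
  by rewrite prsymMl prsymVl.
have Dsym g h : prsym g h \in gen (diag_gens s).
  move: g h; apply: (ind) => [h|g g' Pg Pg' h|g gs].
  - by rewrite /prsym pr1g prg1 mulg1.
  - by rewrite prsymFl; apply: DF.
  apply: (ind) => [|h h' Ph Ph'|h hs].
  - by rewrite /prsym pr1g prg1 mulg1.
  - by rewrite prsymC prsymFl !(prsymC _ g); apply: DF.
  by apply: mem_gen; rewrite mem_cat; apply/orP; right; apply: allpairs_f.
apply: (ind) => [|g h Pg Ph|g gs]; first by rewrite pr1g.
  have -> : p (g / h) (g / h) =
      p g g * (p h h)^-1 * (prsym h h^-1)^-1 * prsym h^-1 g.
    have := prMxx h h^-1; rewrite mulgV pr1g prsymC => /esym e1.
    rewrite prMxx; congr (_ * _); rewrite -mulgA; congr (_ * _).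
    by apply: (mulgI (p h h)); apply: (mulIg (prsym h h^-1)); rewrite e1 !gnorm.
  apply: group_closedM => //; apply: (DF) => //; exact: DF.
apply: mem_gen; rewrite mem_cat; apply/orP; left.
exact: (map_f (fun x => p x x)).
Qed.

Lemma diag_central (s : seq G) :
  {in gen (diag_gens s), forall v w, commute v w}.
Proof.
move=> v; pose Z : {pred W} :=
  [pred v | `[< forall w, w \in @predT W -> commute v w >]].
move=> /genP/(_ (centralizer_closed _ : group_closed Z)) vZ w.
suff /asboolP : v \in Z by apply.
apply: vZ => x /diag_gens_ker dx; apply/asboolP=> y _; exact: ker_central.
Qed.

Lemma diag_noeth (s : seq G) : noeth_on (gen (diag_gens s)).
Proof.
apply: noeth_on_gen_commute => v w /diag_gens_ker dv _; exact: ker_central.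
Qed.

Lemma alternating_prsym :
  (forall g, p g g = 1) -> forall g h, p g h * p h g = 1.
Proof.
move=> p1 g h.
by rewrite -/(prsym g h) -[RHS](p1 (h * g)) prMxx !p1 !mul1g.
Qed.

End CrossedPairing.

(** * Homomorphisms out of a presented group *)

Section Evaluation.
Variables (X : choiceType) (H : groupType) (e : X -> H).

Definition letter_val (x : X * bool) : H := if x.2 then e x.1 else (e x.1)^-1.

Definition word_val (u : word X) : H := \prod_(x <- u) letter_val x.

Lemma word_val_nil : word_val [::] = 1.
Proof. exact: big_nil. Qed.

Lemma word_val_cons x u : word_val (x :: u) = letter_val x * word_val u.
Proof. exact: big_cons. Qed.

Lemma word_val_cat u v : word_val (u ++ v) = word_val u * word_val v.
Proof. exact: big_cat. Qed.

Lemma word_val1 x : word_val [:: (x, true)] = e x.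
Proof. by rewrite word_val_cons word_val_nil mulg1. Qed.

Lemma word_val_pair x y : word_val [:: (x, true); (y, true)] = e x * e y.
Proof. by rewrite word_val_cons word_val1. Qed.

Lemma letter_valV x b : letter_val (x, ~~ b) = (letter_val (x, b))^-1.
Proof. by case: b; rewrite /letter_val /= ?invgK. Qed.

Variable R : word X -> word X -> Prop.
Hypothesis eR : forall u v, R u v -> word_val u = word_val v.

Lemma word_val_cong u v : pres_cong R u v -> word_val u = word_val v.
Proof.
elim=> {u v} //.
- by move=> u v w _ -> _ ->.
- by move=> u u' v v' _ eu _ ev; rewrite !word_val_cat eu ev.
by move=> x b; rewrite !word_val_cons word_val_nil letter_valV mulg1 mulgV.
Qed.

Definition pres_hom (a : presented R) : H := word_val (repr a).

Lemma pres_hom_pi u : pres_hom (\pi_(presented R)%qT u) = word_val u.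
Proof. exact/word_val_cong/pres_repr. Qed.

Lemma pres_homM : {morph pres_hom : a b / a * b}.
Proof. by move=> a b; rewrite [LHS]pres_hom_pi word_val_cat. Qed.

End Evaluation.

Section PresentedGenerators.
Variables (X : choiceType) (R : word X -> word X -> Prop).

Let gn (x : X) : presented R := \pi_(presented R)%qT [:: (x, true)].

Lemma word_val_pi u : word_val gn u = \pi_(presented R)%qT u.
Proof.
elim: u => [|[x b] u IHu]; first by rewrite word_val_nil.
have -> : \pi_(presented R)%qT ((x, b) :: u) =
    \pi_(presented R)%qT [:: (x, b)] * \pi_(presented R)%qT u.
  by rewrite [RHS]pres_mul_pi.
rewrite word_val_cons IHu; congr (_ * _).
by case: b; rewrite // /letter_val /= [LHS]pres_inv_pi.
Qed.

Lemma presented_gen (S : {pred presented R}) :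
    group_closed S -> (forall x, \pi_(presented R)%qT [:: (x, true)] \in S) ->
  forall a, a \in S.
Proof.
move=> cS Sx a; rewrite -[a]reprK -word_val_pi.
elim: (repr a) => [|[x b] u IHu]; first by rewrite word_val_nil; case: cS.
rewrite word_val_cons; apply: (group_closedM cS) => //.
by case: b; last apply: (group_closedV cS); apply: Sx.
Qed.

End PresentedGenerators.

(** * Tensor and exterior square as crossed pairings *)

Section TensorQuotient.
Variables (G : groupType).

(** Any set of relations that contains the tensor relations, is stable under
   conjugation and holds for commutators; this covers both squares. *)
Variable R : word (G * G)%type -> word (G * G)%type -> Prop.
Hypothesis tensor_sub : forall u v, tensor_rel u v -> R u v.

Definition conj_gen (k : G) (x : G * G) : presented R :=
  \pi_(presented R)%qT (tensor_letter (lconj k x.1) (lconj k x.2)).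
Definition lcomm_gen (x : G * G) : G := lcomm x.1 x.2.

Hypothesis conjR :
  forall k u v, R u v -> word_val (conj_gen k) u = word_val (conj_gen k) v.
Hypothesis lcommR :
  forall u v, R u v -> word_val lcomm_gen u = word_val lcomm_gen v.

Definition quo_pr (g h : G) : presented R :=
  \pi_(presented R)%qT (tensor_letter g h).
Definition quo_act (k : G) : presented R -> presented R :=
  pres_hom (conj_gen k) (R := R).
Definition quo_bd : presented R -> G := pres_hom lcomm_gen (R := R).

Lemma quo_act_pr k g h :
  quo_act k (quo_pr g h) = quo_pr (lconj k g) (lconj k h).
Proof. by rewrite [LHS](pres_hom_pi (conjR k)) word_val1. Qed.

Lemma quo_bd_pr g h : quo_bd (quo_pr g h) = lcomm g h.
Proof. by rewrite [LHS](pres_hom_pi lcommR) word_val1. Qed.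

Lemma quo_prMl g g' h :
  quo_pr (g * g') h = quo_act g (quo_pr g' h) * quo_pr g h.
Proof.
rewrite quo_act_pr [RHS]pres_mul_pi.
exact/pres_piP/pres_rel/tensor_sub/tensor_rel_mull.
Qed.

Lemma quo_prMr g h h' :
  quo_pr g (h * h') = quo_pr g h * quo_act h (quo_pr g h').
Proof.
rewrite quo_act_pr [RHS]pres_mul_pi.
exact/pres_piP/pres_rel/tensor_sub/tensor_rel_mulr.
Qed.

Lemma quo_gen (S : {pred presented R}) :
  group_closed S -> (forall g h, quo_pr g h \in S) -> forall w, w \in S.
Proof. by move=> cS Sp; apply: presented_gen => // -[g h]; apply: Sp. Qed.

Definition quo_pairing : crossed_pairing G (presented R) :=
  CrossedPairing quo_prMl quo_prMr (fun k => pres_homM (conjR k)) quo_act_pr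
    (pres_homM lcommR) quo_bd_pr quo_gen.

End TensorQuotient.

Section Squares.
Variable G : groupType.

(** The relations of the tensor square, imposed on a function [f]. *)
Definition biderivation (H : groupType) (f : G -> G -> H) : Prop :=
  (forall g g' h, f (g * g') h = f (lconj g g') (lconj g h) * f g h) /\
  (forall g h h', f g (h * h') = f g h * f (lconj h g) (lconj h h')).

Lemma tensor_rel_val (H : groupType) (f : G -> G -> H) u v :
  biderivation f -> tensor_rel u v ->
  word_val (fun x => f x.1 x.2) u = word_val (fun x => f x.1 x.2) v.
Proof.
by move=> [fl fr] [g g' h|g h h']; rewrite word_val1 word_val_pair /=.
Qed.

Lemma biderivation_lconj (H : groupType) (f : G -> G -> H) k :
  biderivation f -> biderivation (fun g h => f (lconj k g) (lconj k h)).
Proof.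
move=> [fl fr]; have kJ := hom_lconj (lconjM k).
split=> [g g' h|g h h'].
  by rewrite (lconjM k g g') fl (kJ g g') (kJ g h).
by rewrite (lconjM k h h') fr (kJ h g) (kJ h h').
Qed.

Lemma biderivation_lcomm : biderivation (@lcomm G).
Proof. by split=> *; rewrite /lcomm /lconj !gnorm. Qed.

Lemma biderivation_quo R : (forall u v, @tensor_rel G u v -> R u v) ->
  biderivation (quo_pr R).
Proof.
move=> sub; split=> *; rewrite [RHS]pres_mul_pi; apply/pres_piP/pres_rel/sub.
  exact: tensor_rel_mull.
exact: tensor_rel_mulr.
Qed.

Definition tensor_pairing : crossed_pairing G (tensor_square G).
Proof.
apply: (@quo_pairing G (@tensor_rel G)) => // [k|] u v.
  apply: (tensor_rel_val (biderivation_lconj k (biderivation_quo _))).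
  by [].
exact: (tensor_rel_val biderivation_lcomm).
Defined.

Inductive wedge_rel : word (G * G)%type -> word (G * G)%type -> Prop :=
| wedge_tensor u v : tensor_rel u v -> wedge_rel u v
| wedge_diag g : wedge_rel (tensor_letter g g) [::].

Definition wedge_square : groupType := presented wedge_rel.

Definition wedge_pairing : crossed_pairing G wedge_square.
Proof.
apply: (@quo_pairing G wedge_rel) => [u v||].
- exact: wedge_tensor.
- move=> k u v [{}u {}v|g].
    pose wb := biderivation_quo wedge_tensor.
    exact: (tensor_rel_val (biderivation_lconj k wb)).
  rewrite word_val1 word_val_nil; exact/pres_piP/pres_rel/wedge_diag.
move=> u v [{}u {}v|g]; first exact: (tensor_rel_val biderivation_lcomm).
by rewrite word_val1 word_val_nil /lcomm_gen /lcomm /= !gnorm.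
Defined.

Lemma wedge_pairing_xx g : pr wedge_pairing g g = 1.
Proof. exact/pres_piP/pres_rel/wedge_diag. Qed.

Section TensorHom.
Variables (H : groupType) (f : G -> G -> H).
Hypothesis fb : biderivation f.

Definition tensor_hom : tensor_square G -> H :=
  pres_hom (fun x => f x.1 x.2) (R := @tensor_rel G).

Lemma tensor_homM : {morph tensor_hom : v w / v * w}.
Proof. by apply: pres_homM => u v; apply: tensor_rel_val. Qed.

Lemma tensor_hom_pr g h : tensor_hom (pr tensor_pairing g h) = f g h.
Proof.
by rewrite [LHS]pres_hom_pi ?word_val1 // => u v; apply: tensor_rel_val.
Qed.

End TensorHom.

Definition tensor_wedge : tensor_square G -> wedge_square :=
  tensor_hom (pr wedge_pairing).

Lemma tensor_wedge_biderivation : biderivation (pr wedge_pairing).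
Proof. exact/biderivation_quo/wedge_tensor. Qed.

Lemma tensor_wedgeM : {morph tensor_wedge : v w / v * w}.
Proof. exact: tensor_homM tensor_wedge_biderivation. Qed.

Lemma tensor_wedge_pr g h :
  tensor_wedge (pr tensor_pairing g h) = pr wedge_pairing g h.
Proof. exact: (tensor_hom_pr tensor_wedge_biderivation). Qed.

(** The relations [g (x) g = 1] kill no more than a subgroup containing all
   [g (x) g], provided that it is central: congruent words then have values
   that differ by an element of it. *)
Lemma tensor_wedge_ker (S : {pred tensor_square G}) :
    group_closed S -> (forall g, pr tensor_pairing g g \in S) ->
    {in S, forall v w, commute v w} ->
  forall w, tensor_wedge w = 1 -> w \in S.
Proof.
move=> cS Sd Sc w; have [S1 SF] := cS.
pose pi u : tensor_square G := \pi_(presented (@tensor_rel G))%qT u.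
have piM u v : pi (u ++ v) = pi u * pi v by rewrite [RHS]pres_mul_pi.
suff key u v : pres_cong wedge_rel u v -> pi u / pi v \in S.
  move=> w1; rewrite -[w]reprK -[X in X \in S]divg1; apply: (key _ [::]).
  apply/pres_piP; rewrite -[RHS]w1 -word_val_pi.
  by apply: eq_bigr => -[[g h] b].
elim=> {u v}.
- by move=> u; rewrite mulgV.
- by move=> u v _ /(group_closedV cS); rewrite invgF.
- move=> u v t _ uv _ vt; rewrite -(divgKA (pi v)); exact: group_closedM.
- move=> u u' v v' _ uu' _ vv'; rewrite !piM.
  have -> : pi u * pi v / (pi u' * pi v') = pi u * (pi v / pi v') / pi u'.
    by rewrite !gnorm.
  by rewrite -(Sc _ vv') -mulgA; apply: group_closedM.
- move=> x b; suff -> : pi [:: (x, b); (x, ~~ b)] = pi [::] by rewrite mulgV.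
  exact/pres_piP/pres_cancel.
move=> _ _ [u v uv|g].
  suff -> : pi u = pi v by rewrite mulgV.
  exact/pres_piP/pres_rel.
have -> : pi [::] = 1 by [].
by rewrite divg1; apply: Sd.
Qed.

End Squares.

(** * Subgroups and semidirect products as groups *)

Record subgroup_of (G : groupType) (S : {pred G}) (cS : group_closed S) :=
  SubgroupOf { subgroup_val :> G; _ : subgroup_val \in S }.

Section SubgroupOf.
Variables (G : groupType) (S : {pred G}) (cS : group_closed S).

HB.instance Definition _ := [isSub for @subgroup_val G S cS].
HB.instance Definition _ := [Choice of subgroup_of cS by <:].
HB.instance Definition _ :=
  SubChoice_isSubGroup.Build G S (subgroup_of cS) cS.

End SubgroupOf.

Record group_action (H L : groupType) := GroupAction {
  gact :> H -> L -> L;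
  gactM : forall h, {morph gact h : l m / l * m};
  gact_mul : forall h k l, gact (h * k) l = gact h (gact k l);
  gact1 : forall l, gact 1 l = l
}.

Definition semidirect (H L : groupType) (t : group_action H L) : Type :=
  (L * H)%type.

Section Semidirect.
Variables (H L : groupType) (t : group_action H L).
Local Notation sd := (semidirect t).

HB.instance Definition _ := Choice.on sd.

Definition sd_mul (x y : sd) : sd := (x.1 * t x.2 y.1, x.2 * y.2).
Definition sd_inv (x : sd) : sd := (t x.2^-1 x.1^-1, x.2^-1).
Definition sd_one : sd := (1, 1).

Lemma sd_mulA : associative sd_mul.
Proof. by move=> x y z; rewrite /sd_mul /= gactM gact_mul !mulgA. Qed.

Lemma sd_mul1g : left_id sd_one sd_mul.
Proof. by case=> l h; rewrite /sd_mul /= gact1 !mul1g. Qed.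

Lemma sd_mulg1 : right_id sd_one sd_mul.
Proof. by case=> l h; rewrite /sd_mul /= (hom1 (@gactM _ _ t h)) !mulg1. Qed.

Lemma sd_mulVg : left_inverse sd_one sd_inv sd_mul.
Proof.
by case=> l h; rewrite /sd_mul /= -gactM !mulVg (hom1 (@gactM _ _ t _)).
Qed.

Lemma sd_mulgV : right_inverse sd_one sd_inv sd_mul.
Proof. by case=> l h; rewrite /sd_mul /= -gact_mul !mulgV gact1 mulgV. Qed.

HB.instance Definition _ := isGroup.Build sd
  sd_mulA sd_mul1g sd_mulg1 sd_mulVg sd_mulgV.

Lemma sdM (l m : L) (h k : H) :
  ((l, h) : sd) * ((m, k) : sd) = (l * t h m, h * k).
Proof. by []. Qed.

End Semidirect.

(** * Realizing an alternating pairing by commutators *)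

(** A group [L] over [G] containing a copy of [W], in which commutators are
   given by the pairing.  Then [ker pi] is central ([re_ker_central]), so that
   [L] is a central extension of [G] once [pi] is surjective. *)
Record realization (G W : groupType) (T : crossed_pairing G W)
    (L : groupType) (io : W -> L) (pi : L -> G) : Prop := Realization {
  re_ioM : {morph io : v w / v * w};
  re_io_inj : injective io;
  re_piM : {morph pi : l m / l * m};
  re_pi_io : forall w, pi (io w) = bd T w;
  re_act : forall l w, l * io w = io (act T (pi l) w) * l;
  re_comm : forall l m, l * m = io (pr T (pi l) (pi m)) * (m * l)
}.

Section Realization.
Variables (G W : groupType) (T : crossed_pairing G W).
Local Notation p := (pr T).
Local Notation a := (act T).
Local Notation d := (bd T).

Lemma realization_self : realization T (@id W) d.
Proof.
split=> //; first exact: bdM.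
  by move=> l w; rewrite peiffer mulgVK.
by move=> l m; rewrite pr_bd peiffer !gnorm.
Qed.

Lemma re_ker_central (L : groupType) (io : W -> L) (pi : L -> G) l m :
  realization T io pi -> pi l = 1 -> commute l m.
Proof.
move=> re l1; rewrite /commute (re_comm re) l1 pr1g.
by rewrite (hom1 (re_ioM re)) mul1g.
Qed.

Lemma pr_orthogonal_closed g : group_closed [pred h | p g h == 1].
Proof.
split=> [|x y]; rewrite !inE ?prg1 // => /eqP gx /eqP gy.
have a1 k := hom1 (@actM _ _ T k).
by rewrite prMr prVr gx gy a1 invg1 a1 mul1g.
Qed.

Hypothesis pxx : forall g, p g g = 1.

Lemma pr_anti g h : p g h = (p h g)^-1.
Proof. by apply: (mulIg (p h g)); rewrite alternating_prsym // mulVg. Qed.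

(** What is orthogonal to a given element is a subgroup, so [p g g = 1] spreads
   to the powers of [g] in both arguments. *)
Lemma pr_cyclic g : {in gen [:: g] &, forall h k, p h k = 1}.
Proof.
move=> h k hg kg; suff /eqP : k \in [pred k | p h k == 1] by [].
apply: (genP kg (pr_orthogonal_closed h)) => x; rewrite inE => /eqP->.
rewrite inE pr_anti -invg1 eqg_inv.
apply: (genP hg (pr_orthogonal_closed g)) => y; rewrite inE => /eqP->.
by rewrite inE pxx.
Qed.

(** Adjoining lifts of an abelian group [H] over [G] to a realization [L]; the
   pairing has to vanish on [H], because the lifts are to commute. *)
Section Adjoin.
Variables (L : groupType) (io : W -> L) (pi : L -> G).
Hypothesis re : realization T io pi.
Variables (H : groupType) (r : H -> G).
Hypotheses (rC : forall h k : H, h * k = k * h) (rM : {morph r : h k / h * k}).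
Hypothesis (rr : forall h k, p (r h) (r k) = 1).

Let ioM := re_ioM re.
Let piM := re_piM re.

(** In a realization containing a lift [t] of [r h], [re_comm] forces
   [t l t^-1] to be this element. *)
Definition adj_act (h : H) (l : L) : L := io (p (r h) (pi l)) * l.

Lemma adj_actM h : {morph adj_act h : l m / l * m}.
Proof.
move=> l m; rewrite /adj_act piM prMr ioM -!mulgA; congr (_ * _).
by rewrite !mulgA -(re_act re).
Qed.

Lemma pi_adj_act h l : pi (adj_act h l) = lconj (r h) (pi l).
Proof. by rewrite /adj_act piM (re_pi_io re) bd_pr /lcomm /lconj !gnorm. Qed.

Lemma adj_commute h k : r h * r k = r k * r h.
Proof. by rewrite -!rM rC. Qed.

Lemma adj_act_mul h k l : adj_act (h * k) l = adj_act h (adj_act k l).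
Proof.
rewrite {2}/adj_act pi_adj_act /adj_act mulgA -ioM rM adj_commute prMl act_pr.
by congr (io (p _ _ * _) * _); rewrite /lconj adj_commute mulgK.
Qed.

Lemma adj_act1 l : adj_act 1 l = l.
Proof. by rewrite /adj_act (hom1 rM) pr1g (hom1 ioM) mul1g. Qed.

Let t := GroupAction adj_actM adj_act_mul adj_act1.

Definition adj_io (w : W) : semidirect t := (io w, 1).
Definition adj_pi (x : semidirect t) : G := pi x.1 * r x.2.

Lemma realization_adjoin : realization T adj_io adj_pi.
Proof.
have r1 := hom1 rM; split.
- by move=> v w; rewrite /adj_io sdM mulg1 gact1 ioM.
- by move=> v w [/(re_io_inj re)].
- move=> [l h] [m k]; rewrite sdM /adj_pi /= piM pi_adj_act rM /lconj !gnorm //.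
- by move=> w; rewrite /adj_pi /= r1 mulg1 (re_pi_io re).
- move=> [l h] w; rewrite /adj_io !sdM /adj_pi /= mulg1 mul1g adj_act1 actMg.
  congr (_, _); rewrite /adj_act (re_pi_io re) -(re_act re) -ioM.
  by rewrite pr_anti pr_bd invgF mulgVK.
move=> [l h] [m k]; rewrite /adj_io !sdM /adj_pi /= mul1g adj_act1.
rewrite (rC k h); congr (_, _); rewrite /adj_act prMl !prMr rr.
rewrite (hom1 (@actM _ _ T _)) mulg1 !ioM.
(* The two pairings of [pi l] and [r k] cancel by antisymmetry. *)
have e :
    io (a (pi m) (p (pi l) (r k))) * (m * (io (p (r k) (pi l)) * l)) = m * l.
  rewrite (mulgA m) (re_act re) !mulgA -ioM -actM alternating_prsym //.
  by rewrite (hom1 (@actM _ _ T _)) (hom1 ioM) mul1g.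
rewrite -[RHS]mulgA -[X in _ = _ * X]mulgA e -(re_comm re) !mulgA.
by rewrite (re_act re).
Qed.

End Adjoin.

Lemma realization_cyclic (L : groupType) (io : W -> L) (pi : L -> G) g :
  realization T io pi ->
  exists (L' : groupType) (io' : W -> L') (pi' : L' -> G),
    [/\ realization T io' pi', forall l, exists l', pi' l' = pi l &
        exists l', pi' l' = g].
Proof.
move=> re; pose H : groupType := subgroup_of (gen_closed [:: g]).
pose r (h : H) : G := val h.
have rM : {morph r : h k / h * k} by exact: valM.
have rr h k : p (r h) (r k) = 1 by apply: (@pr_cyclic g); apply: valP.
have rC (h k : H) : h * k = k * h.
  apply: val_inj; rewrite !valM.
  apply: (@gen_commute _ [:: g]); try exact: valP.
  by move=> x y; rewrite !inE => /eqP-> /eqP->.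
have re' := realization_adjoin re rC rM rr.
refine (ex_intro _ _ (ex_intro _ _ (ex_intro _ _ (And3 re' _ _)))).
  by move=> l; exists (l, 1); rewrite /adj_pi /= mulg1.
have gg : g \in gen [:: g] by apply: mem_gen; rewrite inE.
exists (1, SubgroupOf (gen_closed [:: g]) gg).
by rewrite /adj_pi /= (hom1 (re_piM re)) mul1g.
Qed.

(** The realization [bd : W -> G] reaches only the commutator subgroup; lifts of
   the generators of [G] are adjoined one at a time. *)
Lemma realization_surj (s : seq G) :
  {subset predT <= gen s} ->
  exists (L : groupType) (io : W -> L) (pi : L -> G),
    realization T io pi /\ forall g, exists l, pi l = g.
Proof.
move=> Gs; suff [L [io [pi [re sr]]]] : exists (L : groupType) (io : W -> L)
    (pi : L -> G), realization T io pi /\ {in s, forall g, exists l, pi l = g}.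
  exists L, io, pi; split=> // g.
  have cpi := image_closed (re_piM re) (_ : group_closed (@predT L)).
  have := genP (Gs g isT) (cpi (conj isT (fun _ _ _ _ => isT))).
  case/(_ _)/asboolP => [x /sr[l <-]|l _ <-]; last by exists l.
  by apply/asboolP; exists l.
elim: {Gs} s => [|g s [L [io [pi [re sr]]]]].
  by exists W, id, d; split=> //; apply: realization_self.
have [L' [io' [pi' [re' old [l' pil']]]]] := realization_cyclic g re.
exists L', io', pi'; split=> // x; rewrite inE => /orP[/eqP->|/sr[l <-]] //.
by exists l'.
Qed.

End Realization.

(** * Central extensions *)

Section CentralExtension.
Variables (G L : groupType) (pi : L -> G) (s : G -> L).
Hypotheses (piM : {morph pi : l m / l * m}) (sK : cancel s pi).
Hypothesis pi_central : forall z l, pi z = 1 -> commute z l.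

Lemma lcomm_central z l m : pi z = 1 -> lcomm (z * l) m = lcomm l m.
Proof.
move=> z1; rewrite /lcomm.
have -> : z * l * m / (z * l) / m = z * (l * m / l) / z / m by rewrite !gnorm.
by rewrite (pi_central (l * m / l) z1) mulgK.
Qed.

Lemma lcommV (x y : L) : (lcomm x y)^-1 = lcomm y x.
Proof. by rewrite /lcomm !gnorm. Qed.

Lemma lcomm_lift l l' m m' :
  pi l = pi l' -> pi m = pi m' -> lcomm l m = lcomm l' m'.
Proof.
move=> el em; have ker x y : pi x = pi y -> pi (x / y) = 1.
  by move=> e; rewrite (homF piM) e mulgV.
rewrite -(mulgVK l' l) (lcomm_central _ _ (ker _ _ el)) -[LHS]invgK lcommV.
by rewrite -(mulgVK m' m) (lcomm_central _ _ (ker _ _ em)) lcommV.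
Qed.

Lemma biderivation_lift : biderivation (fun g h => lcomm (s g) (s h)).
Proof.
have [cl cr] := @biderivation_lcomm L.
split=> [g g' h|g h h'].
  rewrite (@lcomm_lift _ (s g * s g') _ (s h)) ?piM ?sK // cl; congr (_ * _).
  by apply: lcomm_lift; rewrite (hom_lconj piM) !sK.
rewrite (@lcomm_lift _ (s g) _ (s h * s h')) ?piM ?sK // cr; congr (_ * _).
by apply: lcomm_lift; rewrite (hom_lconj piM) !sK.
Qed.

End CentralExtension.

Record centre (L : groupType) :=
  Centre { centre_val :> L; _ : `[< forall l, commute centre_val l >] }.

Section Centre.
Variable L : groupType.

HB.instance Definition _ := [isSub for @centre_val L].
HB.instance Definition _ := [Choice of centre L by <:].

Lemma centreP (z : centre L) (l : L) : commute (val z) l.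
Proof. by have /asboolP := valP z; apply. Qed.

Lemma centreD_proof (z t : centre L) :
  `[< forall l, commute (val z * val t) l >].
Proof.
by apply/asboolP=> l; apply/commute_sym/commuteM; apply/commute_sym/centreP.
Qed.

Lemma centreN_proof (z : centre L) : `[< forall l, commute (val z)^-1 l >].
Proof.
by apply/asboolP=> l; apply/commute_sym/commuteV/commute_sym/centreP.
Qed.

Lemma centre0_proof : `[< forall l : L, commute 1 l >].
Proof. by apply/asboolP=> l; apply/commute_sym/commute1. Qed.

Definition centre_add z t := Centre (centreD_proof z t).
Definition centre_opp z := Centre (centreN_proof z).
Definition centre_zero := Centre centre0_proof.

Lemma centre_addA : associative centre_add.
Proof. by move=> x y z; apply: val_inj; rewrite /= mulgA. Qed.
Lemma centre_addC : commutative centre_add.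
Proof. by move=> x y; apply: val_inj; apply: centreP. Qed.
Lemma centre_add0 : left_id centre_zero centre_add.
Proof. by move=> x; apply: val_inj; rewrite /= mul1g. Qed.
Lemma centre_addN : left_inverse centre_zero centre_opp centre_add.
Proof. by move=> x; apply: val_inj; rewrite /= mulVg. Qed.

HB.instance Definition _ := GRing.isZmodule.Build (centre L)
  centre_addA centre_addC centre_add0 centre_addN.

Lemma centre_valD (z t : centre L) : val (z + t)%R = val z * val t.
Proof. by []. Qed.

End Centre.

(** * The extension of a group by a two-cocycle *)

Record cocycle (G : groupType) (A : zmodType) := Cocycle {
  coc :> G -> G -> A;
  cocP : forall g h k,
    (coc h k - coc (g * h)%g k + coc g (h * k)%g - coc g h = 0)%R
}.

Definition cocycle_ext (G : groupType) (A : zmodType) (f : cocycle G A) :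
  Type := (A * G)%type.

Section CocycleExtension.
Variables (G : groupType) (A : zmodType) (f : cocycle G A).
Local Notation E := (cocycle_ext f).
Local Open Scope ring_scope.

Lemma coc_assoc g h k : f g h + f (g * h)%g k = f h k + f g (h * k)%g.
Proof.
have /eqP := cocP f g h k; rewrite subr_eq0 => /eqP<-.
by rewrite addrAC addrNK.
Qed.

Lemma coc1g g : f 1%g g = f 1%g 1%g.
Proof. by have := coc_assoc 1 1 g; rewrite !mul1g => /addIr. Qed.

Lemma cocg1 g : f g 1%g = f 1%g 1%g.
Proof. by have := coc_assoc g 1 1; rewrite !mulg1 => /addIr. Qed.

Lemma cocVg g : f g^-1%g g = f g g^-1%g.
Proof.
by have := coc_assoc g g^-1 g; rewrite mulgV mulVg coc1g cocg1 => /addIr.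
Qed.

HB.instance Definition _ := Choice.on E.

Definition ext_mul (x y : E) : E := (x.1 + y.1 + f x.2 y.2, (x.2 * y.2)%g).
(* The cocycle is not normalized, so the neutral element is [(- f 1 1, 1)]. *)
Definition ext_one : E := (- f 1%g 1%g, 1%g).
Definition ext_inv (x : E) : E :=
  (- x.1 - f x.2 x.2^-1%g - f 1%g 1%g, x.2^-1%g).

Lemma ext_mulA : associative ext_mul.
Proof.
move=> [a g] [b h] [c k]; rewrite /ext_mul /= mulgA; congr (_, _).
rewrite !addrA [RHS](ACl (1*2*4*(3*5))%AC) /= coc_assoc.
by rewrite addrA.
Qed.

Lemma ext_mul1 : left_id ext_one ext_mul.
Proof.
by case=> a g; rewrite /ext_mul /= mul1g coc1g addrAC addNr add0r.
Qed.

Lemma ext_mulr1 : right_id ext_one ext_mul.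
Proof. by case=> a g; rewrite /ext_mul /= mulg1 cocg1 addrNK. Qed.

Lemma ext_mulV : left_inverse ext_one ext_inv ext_mul.
Proof.
case=> a g; rewrite /ext_mul /= mulVg cocVg; congr (_, _).
by rewrite [LHS](ACl (1*4*(2*5)*3)%AC) /= !addNr !add0r.
Qed.

Lemma ext_mulrV : right_inverse ext_one ext_inv ext_mul.
Proof.
case=> a g; rewrite /ext_mul /= mulgV; congr (_, _).
by rewrite !addrA [LHS](ACl (1*2*(3*5)*4)%AC) /= subrr addNr !add0r.
Qed.

HB.instance Definition _ := isGroup.Build E
  ext_mulA ext_mul1 ext_mulr1 ext_mulV ext_mulrV.

Lemma extM (a b : A) (g h : G) :
  (((a, g) : E) * ((b, h) : E))%g = (a + b + f g h, (g * h)%g).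
Proof. by []. Qed.

Definition ext_proj (x : E) : G := x.2.
Definition ext_sec (g : G) : E := (0, g).
Definition ext_emb (a : A) : E := (a - f 1%g 1%g, 1%g).

Lemma ext_embD a b : ext_emb (a + b) = (ext_emb a * ext_emb b)%g.
Proof.
by rewrite [RHS]extM mulg1 addrA addrNK addrAC.
Qed.

Lemma ext_emb_inj : injective ext_emb.
Proof. by move=> a b [/addIr]. Qed.

Lemma ext_embE (x : E) : x.2 = 1%g -> x = ext_emb (x.1 + f 1%g 1%g).
Proof. by case: x => a g /= ->; rewrite /ext_emb addrK. Qed.

Lemma ext_decomp (x : E) : x = (ext_emb x.1 * ext_sec x.2)%g.
Proof. by case: x => a g; rewrite [RHS]extM mul1g coc1g addr0 addrNK. Qed.

Lemma ext_sec_coc g h :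
  ext_emb (f g h) = (ext_sec g * ext_sec h / ext_sec (g * h)%g)%g.
Proof.
apply: (mulIg (ext_sec (g * h)%g)); rewrite mulgVK.
by rewrite [LHS]extM [RHS]extM mul1g coc1g !addr0 add0r addrNK.
Qed.

Lemma ext_central (z x : E) : ext_proj z = 1%g -> commute z x.
Proof.
case: z x => a g [b h]; rewrite /ext_proj /= => ->.
by rewrite /commute [LHS]extM [RHS]extM mul1g mulg1 coc1g cocg1 [a + b]addrC.
Qed.

(** A section [s] into [L] whose cocycle is the image of [f] under [u] extends
   [u] to a homomorphism. *)
Section Universal.
Variables (L : groupType) (s : G -> L) (u : A -> centre L).
Hypothesis uD : {morph u : a b / a + b}.
Hypothesis us : forall g h, val (u (f g h)) = (s g * s h / s (g * h))%g.

Definition ext_map (x : E) : L := (val (u x.1) * s x.2)%g.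

Lemma ext_mapM : {morph ext_map : x y / (x * y)%g}.
Proof.
move=> [a g] [b h]; rewrite /ext_map /= !uD !centre_valD us !gnorm.
by congr (_ * _)%g; rewrite -!mulgA; congr (_ * _)%g; rewrite centreP.
Qed.

Lemma ext_map_sec g : ext_map (ext_sec g) = s g.
Proof.
have u0 : u 0 = 0 by apply: (addIr (u 0)); rewrite -uD !add0r.
rewrite /ext_map /= u0.
exact: mul1g.
Qed.

End Universal.

End CocycleExtension.

(** * Maps out of free abelian groups and quotients *)

Section FreeAbelian.
Variable X : choiceType.
Local Open Scope ring_scope.

Lemma freeg_ind (P : {freeg X} -> Prop) :
  P 0 -> (forall a b, P a -> P b -> P (a - b)) -> (forall x, P << x >>) ->
  forall a, P a.
Proof.
move=> P0 PB PU a; have PN b : P b -> P (- b) by rewrite -sub0r; apply: PB.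
have PD b c : P b -> P c -> P (b + c).
  by move=> Pb Pc; rewrite -[c]opprK; apply: PB => //; apply: PN.
rewrite -[a]freeg_sumE; elim/big_ind: _ => // x _.
set m := coeff _ _; rewrite -[m]intz -freegU_mulz.
have Pn n : P (<< x >> *+ n) by elim: n => // n IHn; rewrite mulrS; apply: PD.
by case: m => n; [apply: Pn | rewrite NegzE mulrNz; apply/PN/Pn].
Qed.

Variables (V : zmodType) (F : X -> V).

Definition freeg_lift : {freeg X} -> V := fglift (F : X -> zmodule V).

Lemma freeg_lift_is_zmod : zmod_morphism freeg_lift.
Proof. exact: (@lift_is_additive _ _ (zmodule V)). Qed.

HB.instance Definition _ :=
  GRing.isZmodMorphism.Build {freeg X} V freeg_lift freeg_lift_is_zmod.

Lemma freeg_liftU x : freeg_lift << x >> = F x.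
Proof. by rewrite [LHS]liftU scale1r. Qed.

End FreeAbelian.

Section QuotientLift.
Variables (V U : zmodType) (I : zmodClosed V) (F : {additive V -> U}).
Hypothesis F0 : forall x, x \in I -> F x = 0%R.
Local Open Scope ring_scope.
Local Open Scope quotient_scope.
Local Notation Q := (Quotient.quot I).

Definition quot_lift (a : Q) : U := F (repr a).

Lemma quot_lift_pi x : quot_lift (\pi_Q x) = F x.
Proof.
apply/eqP; rewrite -subr_eq0 -raddfB; apply/eqP/F0.
by rewrite Quotient.idealrBE reprK.
Qed.

Lemma quot_liftD : {morph quot_lift : a b / a + b}.
Proof.
move=> a b; rewrite -[a]reprK -[b]reprK.
by rewrite -(raddfD \pi_Q) !quot_lift_pi raddfD.
Qed.

End QuotientLift.

(** * The universal cocycle of the bar complex *)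

Section BarExtension.
Variable G : groupType.
Local Open Scope ring_scope.
Local Open Scope quotient_scope.

Definition bar_boundaries : {pred bar2 G} :=
  [pred c | `[< exists e : bar3 G, c = bar_d3 e >]].

Lemma bar_boundaries_closed : zmod_closed bar_boundaries.
Proof.
split=> [|x y]; first by apply/asboolP; exists 0; rewrite raddf0.
move=> /asboolP[c ->] /asboolP[e ->]; apply/asboolP; exists (c - e).
by rewrite raddfB.
Qed.

HB.instance Definition _ := GRing.isZmodClosed.Build (bar2 G) bar_boundaries
  bar_boundaries_closed.

Definition bar_quot : zmodType := Quotient.quot bar_boundaries.

Lemma bar_pi_eq0 (c : bar2 G) :
  \pi_bar_quot c = 0 <-> exists e : bar3 G, c = bar_d3 e.
Proof.
have -> : 0 = \pi_bar_quot 0 by rewrite raddf0.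
by split=> [/eqP|h]; [|apply/eqP]; rewrite -Quotient.idealrBE subr0;
  [move/asboolP|apply/asboolP].
Qed.

Definition bar_coc (g h : G) : bar_quot := \pi_bar_quot << (g, h) >>.

Lemma bar_cocP g h k :
  bar_coc h k - bar_coc (g * h)%g k + bar_coc g (h * k)%g - bar_coc g h = 0.
Proof.
rewrite /bar_coc -!(raddfB, raddfD); apply/bar_pi_eq0; exists << (g, h, k) >>.
by rewrite [RHS]liftU scale1r.
Qed.

Definition bar_cocycle : cocycle G bar_quot := Cocycle bar_cocP.
Definition bar_ext : groupType := cocycle_ext bar_cocycle.

(** A function on pairs extends linearly to 2-chains, and the cocycle identity
   says that this extension vanishes on the boundaries of basis elements. *)
Lemma bar_universal (A : zmodType) (f : cocycle G A) :
  exists2 u : bar_quot -> A, {morph u : a b / a + b} &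
    forall g h, u (bar_coc g h) = f g h.
Proof.
pose F : {additive bar2 G -> A} := freeg_lift (fun x : G * G => f x.1 x.2).
have FU g h : F << (g, h) >> = f g h by exact: freeg_liftU.
have F0 c : c \in bar_boundaries -> F c = 0.
  move=> /asboolP[e ->]; move: e; apply: freeg_ind => [|a b Fa Fb|[[g h] k]].
  - by rewrite !raddf0.
  - by rewrite !raddfB Fa Fb subr0.
  rewrite [bar_d3 _]liftU scale1r raddfB raddfD raddfB !FU.
  exact: cocP.
exists (quot_lift F (I := bar_boundaries)) => [|g h]; first exact: quot_liftD.
by rewrite [LHS](quot_lift_pi F0) FU.
Qed.

Lemma bar_d2_boundary c : c \in bar_boundaries -> bar_d2 c = 0.
Proof. by move=> /asboolP[e ->]; apply: bar_d2_d3. Qed.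

Definition bar_d2q (a : bar_quot) : bar1 G := quot_lift (@bar_d2 G) a.

Lemma bar_d2q_pi c : bar_d2q (\pi_bar_quot c) = bar_d2 c.
Proof. exact: (quot_lift_pi bar_d2_boundary). Qed.

Lemma bar_d2qD : {morph bar_d2q : a b / a + b}.
Proof. exact/quot_liftD/bar_d2_boundary. Qed.

Lemma bar_d2q0 : bar_d2q 0 = 0.
Proof. by apply: (addIr (bar_d2q 0)); rewrite -bar_d2qD !add0r. Qed.

Lemma bar_d2qB a b : bar_d2q (a - b) = bar_d2q a - bar_d2q b.
Proof. by apply: (addIr (bar_d2q b)); rewrite -bar_d2qD !addrNK. Qed.

(** The abelianization of [bar_ext]; the boundary [h - gh + g] of the cocycle is
   exactly what makes [<< g >>] additive along the canonical section. *)
Definition bar_ab (x : bar_ext) : bar1 G := << x.2 >> + bar_d2q x.1.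

Lemma bar_abM (x y : bar_ext) : bar_ab (x * y)%g = bar_ab x + bar_ab y.
Proof.
case: x y => a g [b h]; rewrite [(_ * _)%g]extM /bar_ab /= !bar_d2qD.
rewrite bar_d2q_pi bar_d2U !addrA.
by rewrite [LHS](ACl ((1*5)*6*2*4*3)%AC) /= subrr add0r.
Qed.

Lemma bar_ab1 : bar_ab 1%g = 0.
Proof. by apply: (addIr (bar_ab 1%g)); rewrite -bar_abM mulg1 add0r. Qed.

Lemma bar_abV (x : bar_ext) : bar_ab x^-1%g = - bar_ab x.
Proof. by apply: (addIr (bar_ab x)); rewrite -bar_abM mulVg bar_ab1 addNr. Qed.

Lemma bar_ab_lcomm (x y : bar_ext) : bar_ab (lcomm x y) = 0.
Proof.
by rewrite /lcomm !bar_abM !bar_abV [LHS](ACl ((1*3)*(2*4))%AC) /= !subrr addr0.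
Qed.

Lemma bar_ab_sec g : bar_ab (ext_sec bar_cocycle g) = << g >>.
Proof. by rewrite /bar_ab /= bar_d2q0 addr0. Qed.

Lemma bar_ab_emb a : bar_ab (ext_emb bar_cocycle a) = bar_d2q a.
Proof.
rewrite /bar_ab /= bar_d2qB bar_d2q_pi bar_d2U mulg1 subrr add0r.
by rewrite addrC addrNK.
Qed.

(** The classes of the basis elements generate [bar_quot], and each of them is
   [lift g * lift h / lift (g * h)]. *)
Lemma bar_ext_words (x : bar_ext) :
  exists u : word G, x = word_val (ext_sec bar_cocycle) u.
Proof.
pose sec := ext_sec bar_cocycle.
pose P (y : bar_ext) := exists u, y = word_val sec u.
have PM y z : P y -> P z -> P (y * z)%g.
  by move=> [u ->] [v ->]; exists (u ++ v); rewrite word_val_cat.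
have Psec g : P (sec g) by exists [:: (g, true)]; rewrite word_val1.
have PV y : P y -> P y^-1%g.
  move=> [u ->]; elim: u => [|[g b] u [v IHu]].
    by exists [::]; rewrite !word_val_nil invg1.
  exists (v ++ [:: (g, ~~ b)]).
  rewrite word_val_cat -IHu !word_val_cons word_val_nil letter_valV mulg1.
  by rewrite invgM.
pose emb := ext_emb bar_cocycle.
have embB a b : emb (a - b) = (emb a / emb b)%g.
  by apply: (mulIg (emb b)); rewrite -ext_embD addrNK mulgVK.
rewrite (ext_decomp x) -/(emb _); apply: (PM) => //.
rewrite -[x.1]reprK; move: (repr x.1); apply: freeg_ind => [|a b Pa Pb|[g h]].
- have -> : emb (\pi_bar_quot 0) = 1%g by rewrite raddf0 /emb /ext_emb sub0r.
  by exists [::]; rewrite word_val_nil.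
- by rewrite raddfB embB; apply: (PM) => //; apply: PV.
rewrite -/(bar_coc g h) /emb (ext_sec_coc bar_cocycle).
by apply: (PM); [apply: (PM)|apply: PV].
Qed.

End BarExtension.

(** A word all of whose exponent sums vanish can be emptied by repeatedly
   cancelling its first letter against an inverse occurrence, at the cost of a
   commutator. *)
Lemma word_val_balanced (X : choiceType) (H : groupType) (e : X -> H)
    (S : {pred H}) (u : word X) :
    group_closed S -> (forall x y, lcomm x y \in S) ->
    (forall x, count_mem (x, true) u = count_mem (x, false) u) ->
  word_val e u \in S.
Proof.
move=> cS Sc; have [n] := ubnP (size u).
elim: n u => // n IHn [|[x b] u] un bal.
  by rewrite word_val_nil; case: cS.
have xu : (x, ~~ b) \in u.
  rewrite -has_pred1 has_count; have := bal x; rewrite /= !xpair_eqE eqxx /=.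
  by case: b un bal => /= _ _; lia.
case/splitPr: xu un bal => v w un bal.
rewrite word_val_cons word_val_cat word_val_cons letter_valV.
set y := letter_val e (x, b); set V := word_val e v; set Z := word_val e w.
have -> : y * (V * (y^-1 * Z)) = lcomm y V * (V * Z) by rewrite /lcomm !gnorm.
apply: group_closedM => //; rewrite /V /Z -word_val_cat; apply: IHn.
  by move: un; rewrite /= !size_cat /=; lia.
move=> z; have := bal z; rewrite /= !count_cat /= !xpair_eqE.
by case: b un bal y => /= _ _ _; case: (x == z); rewrite /=; lia.
Qed.

Section BarCommutators.
Variable G : groupType.
Local Open Scope ring_scope.

Lemma coeff_bar_ab_word (u : word G) x :
  coeff x (bar_ab (word_val (ext_sec (bar_cocycle G)) u)) =
  (count_mem (x, true) u)%:Z - (count_mem (x, false) u)%:Z.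
Proof.
elim: u => [|[g b] u IHu]; first by rewrite word_val_nil bar_ab1 coeff0 subrr.
rewrite word_val_cons bar_abM coeffD IHu /= !xpair_eqE.
have -> : coeff x (bar_ab (letter_val (ext_sec (bar_cocycle G)) (g, b))) =
    if b then (g == x)%:Z else - (g == x)%:Z.
  case: b; rewrite /letter_val /= ?bar_abV bar_ab_sec ?coeffN coeffU mul1r.
    by rewrite natz.
  by rewrite natz.
by case: b; case: (g == x) => /=; lia.
Qed.

Lemma bar_ab_ker (S : {pred bar_ext G}) x :
    group_closed S -> (forall y z, lcomm y z \in S) -> bar_ab x = 0 -> x \in S.
Proof.
move=> cS Sc; have [u ->] := bar_ext_words x => u0.
apply: word_val_balanced => // g; have := coeff_bar_ab_word u g.
by rewrite u0 coeff0 => /esym/eqP; rewrite subr_eq0 eqz_nat => /eqP.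
Qed.

End BarCommutators.

(** * The Schur multiplier inside the universal extension *)

Section SchurMultiplierEmbedding.
Variable G : groupType.
Local Open Scope ring_scope.
Local Open Scope quotient_scope.

Let E : groupType := bar_ext G.
Let M : groupType := Algebra.to_multiplicative (schur_multiplier G).

Definition cycle_class (z : cycle2 G) : bar_quot G := \pi_(bar_quot G) (val z).

Lemma cycle_class_is_zmod : zmod_morphism cycle_class.
Proof. by move=> x y; rewrite /cycle_class !raddfB. Qed.

HB.instance Definition _ :=
  GRing.isZmodMorphism.Build (cycle2 G) (bar_quot G) cycle_class
    cycle_class_is_zmod.

Lemma cycle_class_eq0 z : (z \in @boundaries2 G) <-> cycle_class z = 0.
Proof.
by split=> [/asboolP h|/bar_pi_eq0 h]; [apply/bar_pi_eq0|apply/asboolP].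
Qed.

Definition schur_emb (x : M) : E :=
  ext_emb (bar_cocycle G) (quot_lift cycle_class (x : schur_multiplier G)).

Lemma cycle_class0 z : z \in @boundaries2 G -> cycle_class z = 0.
Proof. by move/cycle_class_eq0. Qed.

Lemma schur_rep (x : M) : exists z : cycle2 G, x = \pi_(schur_multiplier G) z.
Proof. by exists (repr (x : schur_multiplier G)); rewrite reprK. Qed.

Lemma schur_emb_pi (z : cycle2 G) :
  schur_emb (\pi_(schur_multiplier G) z) =
    ext_emb (bar_cocycle G) (cycle_class z).
Proof. by congr (ext_emb _ _); apply: (quot_lift_pi cycle_class0). Qed.

Lemma schur_embM : {morph schur_emb : x y / (x * y)%g}.
Proof.
move=> x y; rewrite /schur_emb -ext_embD; congr (ext_emb _ _).
exact: (quot_liftD cycle_class0).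
Qed.

Lemma schur_emb_inj : injective schur_emb.
Proof.
apply: (hom_inj schur_embM) => x; case: (schur_rep x) => z ->.
rewrite schur_emb_pi => e1; have /cycle_class_eq0 : cycle_class z = 0.
  by apply: (@ext_emb_inj _ _ (bar_cocycle G)); rewrite e1 /ext_emb sub0r.
move=> zB; apply/eqP; change (\pi_(schur_multiplier G) z == 0).
have -> : 0 = \pi_(schur_multiplier G) 0 by rewrite raddf0.
by rewrite -Quotient.idealrBE subr0.
Qed.

Lemma schur_emb_ab x : bar_ab (schur_emb x) = 0.
Proof.
case: (schur_rep x) => z ->; rewrite schur_emb_pi bar_ab_emb bar_d2q_pi.
exact/eqP/(valP z).
Qed.

Lemma schur_emb_range (x : E) :
  ext_proj x = 1%g -> bar_ab x = 0 -> exists z, schur_emb z = x.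
Proof.
move=> /ext_embE ->; rewrite bar_ab_emb.
elim/quotW: (x.1 + _) => c; rewrite bar_d2q_pi => /eqP c0.
by exists (\pi_(schur_multiplier G) (Cycle2 c0)); rewrite schur_emb_pi.
Qed.

End SchurMultiplierEmbedding.

(** * The tensor square over the universal extension *)

Section TensorToExtension.
Variable G : groupType.

Let E : groupType := bar_ext G.
Let T : groupType := tensor_square G.
Let sec : G -> E := ext_sec (bar_cocycle G).
Let proj : E -> G := @ext_proj G _ (bar_cocycle G).

Lemma bar_sec_biderivation : biderivation (fun g h => lcomm (sec g) (sec h)).
Proof.
by apply: (@biderivation_lift _ _ proj) => // z l; apply: ext_central.
Qed.

Definition tensor_ext : T -> E := tensor_hom (fun g h => lcomm (sec g) (sec h)).

Lemma tensor_extM : {morph tensor_ext : v w / v * w}.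
Proof. exact/tensor_homM/bar_sec_biderivation. Qed.

Lemma tensor_ext_pr g h :
  tensor_ext (pr (tensor_pairing G) g h) = lcomm (sec g) (sec h).
Proof. exact: (tensor_hom_pr bar_sec_biderivation). Qed.

Lemma proj_tensor_ext w : proj (tensor_ext w) = bd (tensor_pairing G) w.
Proof.
move: w; apply: (pr_ext (T := tensor_pairing G)) => [v w|v w|x y].
- by rewrite tensor_extM.
- exact: bdM.
by rewrite tensor_ext_pr bd_pr.
Qed.

Lemma bar_ab_tensor_ext w : bar_ab (tensor_ext w) = 0%R.
Proof.
move: w; apply: (pr_ind (T := tensor_pairing G)) => [|v w hv hw|x y].
- by rewrite (hom1 tensor_extM) bar_ab1.
- by rewrite (homF tensor_extM) bar_abM bar_abV hv hw subr0.
by rewrite tensor_ext_pr bar_ab_lcomm.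
Qed.

(** The image of [tensor_ext] contains all commutators of the extension, hence
   the kernel of its abelianization. *)
Lemma schur_emb_tensor_ext
    (x : Algebra.to_multiplicative (schur_multiplier G)) :
  exists w, tensor_ext w = schur_emb x.
Proof.
pose S : {pred E} :=
  [pred y | `[< exists2 w, w \in @predT T & tensor_ext w = y >]].
suff /asboolP[w _ ew] : schur_emb x \in S by exists w.
apply: bar_ab_ker; [by apply: (image_closed tensor_extM)| |exact: schur_emb_ab].
move=> y z; apply/asboolP.
exists (pr (tensor_pairing G) (proj y) (proj z)) => //; rewrite tensor_ext_pr.
by apply: (@lcomm_lift _ _ proj) => // t l; apply: ext_central.
Qed.

(** A surjective realization [L] of the exterior square is a central extension
   of [G], so the universal extension maps to it over [G].  Commutators go to
   commutators, which in [L] are the values of the pairing, and [W] embeds in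
   [L]. *)
Lemma tensor_ext_wedge (s : seq G) w :
  {subset predT <= gen s} -> tensor_ext w = 1 -> tensor_wedge w = 1.
Proof.
move=> Gs w1.
have [L [io [pi [re surj]]]] := realization_surj (@wedge_pairing_xx G) Gs.
have [sL sLK] : exists sL : G -> L, cancel sL pi.
  by have [sL hs] := choice surj; exists sL.
have piM := re_piM re.
have cenP g h : `[< forall l, commute (sL g * sL h / sL (g * h)) l >].
  apply/asboolP=> l; apply: (re_ker_central _ re).
  by rewrite (homF piM) piM !sLK mulgV.
pose f g h := Centre (cenP g h).
have fP g h k : (f h k - f (g * h)%g k + f g (h * k)%g - f g h = 0)%R.
  have fA : (f h k + f g (h * k)%g = f g h + f (g * h)%g k)%R.
    rewrite addrC; apply: val_inj; rewrite !centre_valD /=.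
    set c := sL h * sL k / sL (h * k).
    have cP l : commute c l := centreP (f h k) l.
    rewrite -[LHS](cP (_ / _)) !mulgA (cP (sL g)) -(mulgA (sL g) c).
    by rewrite /c mulgVK !gnorm.
  by rewrite [LHS](ACl ((1*3)*(4*2))%AC) /= fA -opprD subrr.
have [u uD uf] := bar_universal (Cocycle fP).
pose psi := ext_map (f := bar_cocycle G) sL u.
have us g h : val (u (bar_cocycle G g h)) = sL g * sL h / sL (g * h).
  by rewrite uf.
have psiM : {morph psi : x y / x * y} by apply: ext_mapM.
apply: (re_io_inj re); rewrite (hom1 (re_ioM re)) -(hom1 psiM) -w1.
move: (w); apply: (pr_ext (T := tensor_pairing G)) => [v v'|v v'|x y].
- by rewrite tensor_wedgeM (re_ioM re).
- by rewrite tensor_extM psiM.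
rewrite tensor_ext_pr (hom_lcomm psiM) /psi !ext_map_sec //.
by rewrite tensor_wedge_pr /lcomm [sL x * sL y](re_comm re) !sLK !gnorm.
Qed.

End TensorToExtension.

(** * The Noetherian criterion *)

Theorem proposition5p9 (G : groupType) (hG : noetherian G) :
  noetherian (tensor_square G) <->
  fg_group (Algebra.to_multiplicative (schur_multiplier G)).
Proof.
have [s _ Gs] : exists2 s, {subset s <= @predT G} & {subset predT <= gen s}.
  by apply/fg_subgroupP/hG.
pose M : groupType := Algebra.to_multiplicative (schur_multiplier G).
split=> [/noetherianE nT | fgM].
  have nM : noeth_on (@predT M).
    have cT : group_closed (@predT (tensor_square G)) by [].
    apply: (noeth_on_inj (@schur_embM G) (@schur_emb_inj G)
      _ (noeth_on_image (@tensor_extM G) cT nT)) => x _.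
    by apply/asboolP; have [w <-] := schur_emb_tensor_ext x; exists w.
  by apply: nM.
have nM : noeth_on (@predT M).
  have [t _ Mt] := proj1 (fg_subgroupP _) fgM.
  apply: noeth_onS Mt _; apply: noeth_on_gen_commute => x y _ _.
  exact: GRing.addrC.
set tp := tensor_pairing G; apply/noetherianE.
(* Peel off first the image [G, G], then the image of the kernel in the Schur
   multiplier; what remains lies in the central subgroup of the diagonal. *)
apply: (noeth_on_ext (@bdM _ _ tp) (Q := predT)) => //.
  exact/noetherianE.
have cM : group_closed (@predT M) by [].
apply: (noeth_on_ext (@tensor_extM G) _
  (noeth_on_image (@schur_embM G) cM nM)) => [w /andP[_ /eqP w1]|].
  have p1 : ext_proj (tensor_ext w) = 1 by rewrite -w1 -proj_tensor_ext.
  have [z <-] := schur_emb_range p1 (bar_ab_tensor_ext w).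
  by apply/asboolP; exists z.
apply: (noeth_onS _ (@diag_noeth _ _ tp s)) => w /andP[_ /eqP w1].
apply: (tensor_wedge_ker (gen_closed _) (@diag_fg _ _ tp s Gs) _
  (tensor_ext_wedge Gs w1)).
exact: diag_central.
Qed.
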